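(* Let $p$ be a prime and let $G$ be a finite $p$-group of nilpotency class $2$ and exponent $p$, with commutator map $\beta:V\times V\to W$, where $V:=G/Z(G)$ and $W:=G'$. For $r\ge 1$ set $$N_r(V,\beta):=\big|\{(v_1,\dots,v_r)\in V^r:\ \beta(v_i,v_j)=0\ \forall i<j\}\big|.$$ Then $$|\mathrm{Comm}_r(G)|=|Z(G)|^r\,N_r(V,\beta),\qquad\text{and hence}\qquad P_r(G)=\frac{N_r(V,\beta)}{|V|^r}.$$ In particular, $P_r(G)$ depends only on the alternating bilinear map $\beta$ on $V$ (and not on $|Z(G)|$).
   Context: For a finite group $G$ and $r\ge 1$, $\mathrm{Comm}_r(G):=\{(x_1,\dots,x_r)\in G^r : x_ix_j=x_jx_i\ \text{for all } i,j\}$ and $P_r(G):=|\mathrm{Comm}_r(G)|/|G|^r$. For $G$ of class $2$ and exponent $p$, the groups $V=G/Z(G)$ and $W=G'$ (commutator subgroup) are naturally $\mathbb F_p$-vector spaces (written additively), and the commutator induces the alternating $\mathbb F_p$-bilinear map $\beta:V\times V\to W$, $\beta(xZ(G),yZ(G))=[x,y]$. *)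

(* Defs.v *)
From HB Require Import structures.
From mathcomp Require Import all_boot all_order all_fingroup all_algebra.
From mathcomp Require Import all_solvable.

Set Implicit Arguments.
Unset Strict Implicit.
Unset Printing Implicit Defensive.

Import GRing.Theory.
Local Open Scope group_scope.

Definition Comm (r : nat) (gT : finGroupType) (G : {set gT}) :
    {set {ffun 'I_r -> gT}} :=
  [set x : {ffun 'I_r -> gT} |
    [forall i, x i \in G] && [forall i, forall j, x i * x j == x j * x i]].

Definition comm_prob (r : nat) (gT : finGroupType) (G : {set gT}) : rat :=
  (#|Comm r G|%:R / #|G|%:R ^+ r)%R.

Section AlternatingMaps.

Local Open Scope ring_scope.

Variable F : nzRingType.

Definition alternating (V W : lmodType F) (beta : V -> V -> W) : Prop :=
  forall v, beta v v = 0.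

Definition isotropic_tuples (r : nat) (V : finLmodType F) (W : lmodType F)
    (beta : {bilinear V -> V -> W}) : {set {ffun 'I_r -> V}} :=
  [set v : {ffun 'I_r -> V} |
    [forall i : 'I_r, forall j : 'I_r, (i < j)%N ==> (beta (v i) (v j) == 0)]].

Definition bilinear_iso (V1 W1 V2 W2 : lmodType F)
    (beta1 : {bilinear V1 -> V1 -> W1}) (beta2 : {bilinear V2 -> V2 -> W2}) :
    Prop :=
  exists (phi : {linear V1 -> V2}) (psi : {linear W1 -> W2}),
    [/\ bijective phi, bijective psi &
        forall u v, psi (beta1 u v) = beta2 (phi u) (phi v)].

End AlternatingMaps.

(* An elementary abelian p-group written additively, as an 'F_p-module:       *)
(* x + y is the group product x * y, and a *: x is the power x ^+ a.          *)
Definition abelem_space (p : nat) (gT : finGroupType) (E : {group gT})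
  (p_pr : prime p) (abE : p.-abelem E) : predArgType := subg_of E.

Section AbelemSpace.

Variables (p : nat) (gT : finGroupType) (E : {group gT}).
Variables (p_pr : prime p) (abE : p.-abelem E).

Local Notation V := (abelem_space p_pr abE).

HB.instance Definition _ := Finite.copy V (subg_of E).

Definition abelem_zero : V := 1 : subg_of E.
Definition abelem_opp (x : V) : V := (x : subg_of E)^-1.
Definition abelem_add (x y : V) : V := (x : subg_of E) * y.
Definition abelem_scale (a : 'F_p) (x : V) : V := (x : subg_of E) ^+ a.

Fact abelem_addA : associative abelem_add.
Proof. exact: (@mulgA (subg_of E)). Qed.

Fact abelem_addC : commutative abelem_add.
Proof.
move=> x y; apply: val_inj => /=.
by apply: (centsP (abelem_abelian abE)); apply: subgP.
Qed.

Fact abelem_add0 : left_id abelem_zero abelem_add.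
Proof. exact: (@mul1g (subg_of E)). Qed.

Fact abelem_addN : left_inverse abelem_zero abelem_opp abelem_add.
Proof. exact: (@mulVg (subg_of E)). Qed.

HB.instance Definition _ :=
  GRing.isZmodule.Build V abelem_addA abelem_addC abelem_add0 abelem_addN.

Fact abelem_expg_mod (x : subg_of E) (n : nat) :
  x ^+ (n %% (Zp_trunc (pdiv p)).+2) = x ^+ n.
Proof.
rewrite Fp_cast //; apply: expg_mod; apply: val_inj.
rewrite /= (morphX (sgval_morphism E)) ?inE //=.
by case/and3P: abE => _ _ /exponentP; apply; apply: subgP.
Qed.

Fact abelem_scaleA (a b : 'F_p) (x : V) :
  abelem_scale a (abelem_scale b x) = abelem_scale (a * b)%R x.
Proof. by rewrite /abelem_scale /= abelem_expg_mod mulnC expgM. Qed.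

Fact abelem_scale1 : left_id 1%R abelem_scale.
Proof. by move=> x; rewrite /abelem_scale /= modn_small ?expg1. Qed.

Fact abelem_scaleDr : right_distributive abelem_scale +%R.
Proof.
by move=> a x y; apply: expgMn; apply: abelem_addC.
Qed.

Fact abelem_scaleDl (x : V) : {morph abelem_scale^~ x : a b / (a + b)%R}.
Proof.
move=> a b; rewrite /abelem_scale /= abelem_expg_mod.
exact: expgnDr.
Qed.

HB.instance Definition _ := GRing.Zmodule_isLmodule.Build 'F_p V
  abelem_scaleA abelem_scale1 abelem_scaleDr abelem_scaleDl.

End AbelemSpace.

Record class2_exponent (p : nat) (gT : finGroupType) (G : {group gT}) : Prop :=
  Class2Exponent {
    class2_prime : prime p;
    class2_pgroup : p.-group G;
    class2_nil_class : nil_class G = 2;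
    class2_exponentE : exponent G = p
  }.

Section CommutatorMap.

Variables (p : nat) (gT : finGroupType) (G : {group gT}).
Hypothesis hG : class2_exponent p G.

Fact class2_der_sub_center : G^`(1) \subset 'Z(G).
Proof.
have nilG := pgroup_nil (class2_pgroup hG).
have : nil_class G <= 2 by rewrite (class2_nil_class hG).
by rewrite nil_class2.
Qed.

Fact class2_abelem_quotient : p.-abelem (G / 'Z(G)).
Proof.
apply/and3P; split.
- exact: quotient_pgroup (class2_pgroup hG).
- by rewrite sub_der1_abelian ?class2_der_sub_center.
- by rewrite (dvdn_trans (exponent_quotient _ _)) // (class2_exponentE hG).
Qed.

Fact class2_abelem_der : p.-abelem (G^`(1)).
Proof.
apply/and3P; split.
- exact: pgroupS (der_sub 1 G) (class2_pgroup hG).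
- apply: abelianS class2_der_sub_center (center_abelian G).
- by rewrite -(class2_exponentE hG) exponentS ?der_sub.
Qed.

Definition central_quotient : predArgType :=
  abelem_space (class2_prime hG) class2_abelem_quotient.
Definition derived_space : predArgType :=
  abelem_space (class2_prime hG) class2_abelem_der.

HB.instance Definition _ := GRing.Lmodule.on central_quotient.
HB.instance Definition _ := Finite.on central_quotient.
HB.instance Definition _ := GRing.Lmodule.on derived_space.
HB.instance Definition _ := Finite.on derived_space.

Definition comm_map (v w : central_quotient) : derived_space :=
  subg G^`(1) [~ repr (sgval v), repr (sgval w)].

Definition center_coset (x : gT) : central_quotient :=
  subg (G / 'Z(G)) (coset 'Z(G) x).

Fact center_coset_norm x : x \in G -> x \in 'N('Z(G)).
Proof. exact: (subsetP (normal_norm (center_normal G))). Qed.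

Fact center_coset_val x : x \in G -> sgval (center_coset x) = coset 'Z(G) x.
Proof. by move=> Gx; rewrite /center_coset subgK ?mem_quotient. Qed.

Fact center_cosetM x y : x \in G -> y \in G ->
  center_coset (x * y) = (center_coset x + center_coset y)%R.
Proof.
move=> Gx Gy; apply: val_inj.
rewrite /= !center_coset_val ?groupM // morphM //;
  exact: center_coset_norm.
Qed.

Fact center_cosetX x (a : 'F_p) : x \in G ->
  center_coset (x ^+ a) = (a *: center_coset x)%R.
Proof.
move=> Gx; apply: val_inj.
rewrite /= (morphX (sgval_morphism _)) ?inE //=.
rewrite !center_coset_val ?groupX // morphX //.
exact: center_coset_norm.
Qed.

Fact center_cosetP (v : central_quotient) :
  exists2 x, x \in G & v = center_coset x.
Proof.
have /morphimP[x Nx Gx def_v] := subgP v.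
by exists x => //; apply: val_inj; rewrite /= center_coset_val.
Qed.

Fact comm_map_val x y : x \in G -> y \in G ->
  sgval (comm_map (center_coset x) (center_coset y)) = [~ x, y].
Proof.
have repr_coset z : z \in G ->
    exists2 c, c \in 'Z(G) & repr (sgval (center_coset z)) = c * z.
  move=> Gz; have Nz := center_coset_norm Gz.
  rewrite center_coset_val // val_coset //=.
  by have /rcosetP[c Zc ->] := mem_repr_rcoset 'Z(G) z; exists c.
move=> Gx Gy; rewrite /comm_map.
have [c Zc ->] := repr_coset x Gx; have [d Zd ->] := repr_coset y Gy.
have /centerP[Gc cGc] := Zc; have /centerP[Gd cGd] := Zd.
have -> : [~ c * x, d * y] = [~ x, y].
  have cc u : u \in G -> [~ c, u] = 1.
    by move=> Gu; apply/eqP/commgP; exact: cGc.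
  have dd u : u \in G -> [~ u, d] = 1.
    by move=> Gu; apply/eqP/commgP; apply: commute_sym; exact: cGd.
  rewrite commMgJ cc ?groupM // conj1g mul1g.
  by rewrite commgMJ dd // conj1g mulg1.
by rewrite subgK ?mem_commg.
Qed.

(* The choice of coset representatives made by repr in comm_map is harmless.  *)
Lemma comm_mapE x y : x \in G -> y \in G ->
  comm_map (center_coset x) (center_coset y) = subg G^`(1) [~ x, y].
Proof.
by move=> Gx Gy; apply: val_inj; rewrite /= comm_map_val ?subgK ?mem_commg.
Qed.

Lemma comm_map_alternating : alternating comm_map.
Proof.
move=> v; have [x Gx ->] := center_cosetP v.
by apply: val_inj; rewrite /= comm_map_val // commgg.
Qed.

Fact class2_comm_central x y z : x \in G -> y \in G -> z \in G ->
  commute [~ x, y] z.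
Proof.
move=> Gx Gy Gz.
have /centerP[_] := subsetP class2_der_sub_center _ (mem_commg Gx Gy).
exact.
Qed.

Fact class2_commMg x y z : x \in G -> y \in G -> z \in G ->
  [~ x * y, z] = [~ x, z] * [~ y, z].
Proof.
move=> Gx Gy Gz; rewrite commMgJ; congr (_ * _).
apply/conjg_fixP/commgP.
exact: class2_comm_central.
Qed.

Fact class2_commgM x y z : x \in G -> y \in G -> z \in G ->
  [~ x, y * z] = [~ x, y] * [~ x, z].
Proof.
move=> Gx Gy Gz; rewrite commgMJ.
have -> : [~ x, y] ^ z = [~ x, y].
  by apply/conjg_fixP/commgP; exact: class2_comm_central.
by apply: class2_comm_central; rewrite ?groupR.
Qed.

Fact comm_map_bilinear : bilinear_for *:%R%R *:%R%R comm_map.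
Proof.
split=> [w a u v | w a u v];
  have [x Gx ->] := center_cosetP u; have [y Gy ->] := center_cosetP v;
  have [z Gz ->] := center_cosetP w;
  rewrite -center_cosetX // -center_cosetM ?groupX //; apply: val_inj;
  rewrite /= (morphX (sgval_morphism _)) ?inE //= !comm_map_val ?groupM ?groupX //.
- rewrite class2_commMg ?groupX // commXg //.
  by apply: commute_sym; apply: class2_comm_central.
- rewrite class2_commgM ?groupX // commgX //.
  by apply: commute_sym; apply: class2_comm_central.
Qed.

HB.instance Definition _ := bilinear_isBilinear.Build 'F_p
  central_quotient central_quotient derived_space *:%R%R *:%R%R comm_map
  comm_map_bilinear.

End CommutatorMap.
Arguments comm_map {p gT G} hG v w.
Arguments center_coset {p gT G} hG x.

(* Main.v *)
Require Import Defs.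
From mathcomp Require Import all_boot all_order all_fingroup all_algebra.
From mathcomp Require Import all_solvable.

(** Commuting in a group of class 2 is a property of cosets of the centre: two
    elements [x], [y] commute exactly when their images in [V := G / 'Z(G)] are
    orthogonal for the commutator map (lemma [comm_map_eq0]).  Commuting
    [r]-tuples of [G] are therefore the tuples that lie, coordinate by
    coordinate, over an isotropic [r]-tuple of [V].  Over each tuple of [V]
    there are [#|'Z(G)| ^ r] tuples of [G], one coset of the centre for each
    coordinate ([card_center_coset_tuples]), and summing over the isotropic
    tuples gives the count of commuting tuples ([card_Comm_isotropic]).  The
    formula for the probability follows by dividing by
    [#|G| ^ r = #|'Z(G)| ^ r * #|V| ^ r].  What remains is expressed in terms of
    the bilinear map alone, and composition with an isomorphism of bilinear maps
    is a bijection on isotropic tuples, so the probability is an invariant of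
    the map up to isomorphism. *)

Local Open Scope group_scope.

Section Isometry.

Set Implicit Arguments.
Unset Strict Implicit.
Import GRing.Theory.
Local Open Scope ring_scope.

Variables (F : nzRingType) (V1 V2 : finLmodType F) (W1 W2 : lmodType F).
Variables (beta1 : {bilinear V1 -> V1 -> W1}).
Variables (beta2 : {bilinear V2 -> V2 -> W2}).

(** Injectivity of the map between the targets gives both directions:
    a value of the first form vanishes if and only if its image does. *)
Lemma card_isotropic_tuples_iso (r : nat) : bilinear_iso beta1 beta2 ->
  #|isotropic_tuples r beta1| = #|isotropic_tuples r beta2|.
Proof.
case=> phi [psi [[phi' phiK phi'K] /bij_inj psi_inj psiE]].
pose post (v : {ffun 'I_r -> V1}) := [ffun i => phi (v i)].
have post_inj : injective post.
  move=> u v /ffunP uv; apply/ffunP=> i.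
  by have := uv i; rewrite !ffunE => /(can_inj phiK).
rewrite -(card_imset _ post_inj); apply: eq_card => w.
have eq0 u v : (beta2 (phi u) (phi v) == 0) = (beta1 u v == 0).
  by rewrite -psiE -(inj_eq psi_inj) linear0.
have mem_post v : (post v \in isotropic_tuples r beta2) =
                  (v \in isotropic_tuples r beta1).
  by rewrite !inE; do 2![apply: eq_forallb => ?]; rewrite !ffunE eq0.
have -> : w = post [ffun i => phi' (w i)].
  by apply/ffunP=> i; rewrite !ffunE phi'K.
by rewrite mem_post mem_imset.
Qed.

Lemma card_bilinear_iso : bilinear_iso beta1 beta2 -> #|V1| = #|V2|.
Proof. by case=> phi [psi [/bij_eq_card]]. Qed.

End Isometry.

Section CommutingTuples.

Set Implicit Arguments.
Unset Strict Implicit.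
Import GRing.Theory Num.Theory.

Variables (p : nat) (gT : finGroupType) (G : {group gT}).
Hypothesis hG : class2_exponent p G.

(** The value of the commutator map on two cosets is the commutator of any
    representatives, so its vanishing says that the representatives commute. *)
Lemma comm_map_eq0 x y : x \in G -> y \in G ->
  (comm_map hG (center_coset hG x) (center_coset hG y) == 0%R)
    = (x * y == y * x).
Proof.
move=> Gx Gy; rewrite -(inj_eq val_inj) /= comm_map_val //.
by apply/commgP/eqP.
Qed.

(** Elements of [V] are cosets, hence subsets of [gT]: the fibre of the
    projection [G -> V] over [v] is [v] itself.  Membership in [G] is implied on
    the right because ['Z(G)] is contained in [G]. *)
Lemma center_coset_eq x (v : central_quotient hG) :
  (x \in G) && (center_coset hG x == v) = (x \in set_of_coset (sgval v)).
Proof.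
have [y Gy ->] := center_cosetP v.
have Ny := center_coset_norm Gy.
rewrite center_coset_val // val_coset //=.
have [Gx | nGx] /= := boolP (x \in G); last first.
  apply/esym/negbTE; apply: contra nGx => /rcosetP[z Zz ->].
  by rewrite groupM // (subsetP (center_sub G)).
have Nx := center_coset_norm Gx.
rewrite -(inj_eq val_inj) /= !center_coset_val //.
exact: (sameP eqP (rcoset_kercosetP Nx Ny)).
Qed.

Lemma card_central_coset (v : central_quotient hG) :
  #|set_of_coset (sgval v)| = #|'Z(G)|.
Proof.
have [y Gy ->] := center_cosetP v.
by rewrite center_coset_val // val_coset ?center_coset_norm //= card_rcoset.
Qed.

Definition center_coset_tuple {r} (x : {ffun 'I_r -> gT}) :
    {ffun 'I_r -> central_quotient hG} := [ffun i => center_coset hG (x i)].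

(** The fibre of the projection [G^r -> V^r] over [v] is a product of [r] cosets
    of the centre. *)
Lemma card_center_coset_tuples r (v : {ffun 'I_r -> central_quotient hG}) :
  #|[set x : {ffun 'I_r -> gT} |
      [forall i, x i \in G] && (center_coset_tuple x == v)]| = (#|'Z(G)| ^ r)%N.
Proof.
pose cosets (i : 'I_r) : pred gT := [pred y | y \in set_of_coset (sgval (v i))].
have -> : (#|'Z(G)| ^ r)%N = #|family cosets|.
  rewrite card_family foldrE big_map big_enum /=.
  rewrite (eq_bigr (fun=> #|'Z(G)|)) => [|i _]; last exact: card_central_coset.
  by rewrite prod_nat_const card_ord.
apply: eq_card => x; rewrite inE.
apply/andP/familyP => [[/forallP Gx /eqP def_v] i | x_v].
  by rewrite inE /= -center_coset_eq Gx -def_v ffunE eqxx.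
have {}x_v i : (x i \in G) && (center_coset hG (x i) == v i).
  by rewrite center_coset_eq; apply: x_v.
split; first by apply/forallP=> i; case/andP: (x_v i).
by apply/eqP/ffunP=> i; rewrite ffunE; case/andP: (x_v i) => _ /eqP.
Qed.

(** Isotropy only constrains pairs [i < j]; this suffices because commutation is
    reflexive and symmetric. *)
Lemma Comm_isotropic r (x : {ffun 'I_r -> gT}) : (forall i, x i \in G) ->
  (x \in Comm r G) = (center_coset_tuple x \in isotropic_tuples r (comm_map hG)).
Proof.
move=> Gx; rewrite !inE (introT forallP Gx) /=.
apply/'forall_'forall_eqP/'forall_'forall_implyP => [cx i j _ | isox i j].
  by rewrite !ffunE comm_map_eq0 // cx.
have lt_comm (k l : 'I_r) : (k < l)%N -> x k * x l = x l * x k.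
  by move/isox; rewrite !ffunE comm_map_eq0 // => /eqP.
by case: (ltngtP i j) => [/lt_comm | /lt_comm | /val_inj->].
Qed.

Lemma card_Comm_isotropic r :
  #|Comm r G| = (#|'Z(G)| ^ r * #|isotropic_tuples r (comm_map hG)|)%N.
Proof.
have CommG (x : {ffun 'I_r -> gT}) : x \in Comm r G -> forall i, x i \in G.
  by rewrite inE => /andP[/forallP].
rewrite -sum1_card (partition_big center_coset_tuple
  (mem (isotropic_tuples r (comm_map hG)))) /= => [|x Cx]; last first.
  by rewrite -Comm_isotropic //; apply: CommG.
rewrite mulnC -sum_nat_const; apply: eq_bigr => v iso_v.
rewrite -(card_center_coset_tuples v) -sum1_card; apply: eq_bigl => x.
rewrite [RHS]inE; apply/andP/andP => [[Cx ->] | [/forallP Gx /eqP def_v]].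
  by split=> //; apply/forallP/CommG.
by rewrite Comm_isotropic // def_v eqxx.
Qed.

Lemma card_central_quotient : (#|'Z(G)| * #|central_quotient hG|)%N = #|G|.
Proof.
have -> : #|central_quotient hG| = #|G / 'Z(G)| by apply: (card_sub (subg_of (G / 'Z(G)))).
by rewrite card_quotient ?normal_norm ?center_normal // Lagrange ?center_sub.
Qed.

Lemma comm_prob_isotropic r :
  comm_prob r G = (#|isotropic_tuples r (comm_map hG)|%:R
                     / #|central_quotient hG|%:R ^+ r)%R :> rat.
Proof.
rewrite /comm_prob card_Comm_isotropic -card_central_quotient.
rewrite !natrM natrX exprMn.
rewrite -mulf_div divff ?mul1r //.
by rewrite expf_neq0 // pnatr_eq0 -lt0n cardG_gt0.
Qed.

End CommutingTuples.

Theorem proposition7p9 (p : nat) (gT : finGroupType) (G : {group gT})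
    (hG : class2_exponent p G) (r : nat) (r_ge1 : 1 <= r) :
  [/\ #|Comm r G|
         = (#|'Z(G)| ^ r * #|isotropic_tuples r (comm_map hG)|)%N,
      comm_prob r G
         = (#|isotropic_tuples r (comm_map hG)|%:R
              / #|central_quotient hG|%:R ^+ r)%R :> rat
    & forall (hT : finGroupType) (H : {group hT}) (hH : class2_exponent p H),
        bilinear_iso (comm_map hG) (comm_map hH) ->
        comm_prob r G = comm_prob r H].
Proof.
split=> [||hT H hH iso_GH].
- exact: card_Comm_isotropic.
- exact: comm_prob_isotropic.
- rewrite (comm_prob_isotropic hG) (comm_prob_isotropic hH).
  rewrite (card_isotropic_tuples_iso _ iso_GH).
  by rewrite (card_bilinear_iso iso_GH).
Qed.
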